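(* Let $1\le k\le n$, let $\mathcal S\subset\mathcal P_n$ be the stabilizer group of a stabilizer code with logical Pauli group $\mathcal L$, and let $D$ be a decoding map. Let $p\in[0,1)$, $z=p/(3-3p)$, $p_{\rm QEC}\in[0,1]$, and write $W(A)=W(A;z)$. Then the infidelity of the QEC-only protocol is $$1-F_{\rm QEC}=\frac{1}{W(\tilde{\mathcal P}_n)}\Bigl[W(N\setminus T)+W(\tilde{\mathcal P}_n\setminus(K\cup N))+p_{\rm QEC}\bigl[W(K\setminus T)-4^{-k}\bigl(W(\tilde{\mathcal P}_n\setminus(K\cup N))+W(K\setminus T)\bigr)\bigr]\Bigr]$$ $$=\frac{1}{W(\tilde{\mathcal P}_n)}\Bigl[W(\tilde{\mathcal P}_n\setminus K)+p_{\rm QEC}\bigl(W(K\setminus T)-4^{-k}W(\tilde{\mathcal P}_n\setminus N)\bigr)\Bigr].$$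
   Context: Paulis. $\mathcal P_n$ is the $n$-qubit Pauli group (with phases $\pm1,\pm i$), $\tilde{\mathcal P}_n=\mathcal P_n/\langle iI\rangle$, and $\pi:\mathcal P_n\to\tilde{\mathcal P}_n$ is the projection. Elements of $\tilde{\mathcal P}_n$ are represented by strings in $\{I,X,Y,Z\}^n$; $\mathrm{wt}(E')$ is the number of non-identity letters. Two elements of $\tilde{\mathcal P}_n$ are said to commute (anticommute) if their representatives in $\mathcal P_n$ do. Code. $\mathcal S\subset\mathcal P_n$ is a subgroup with $2^{n-k}$ elements not containing $-I$. $C(\mathcal S)$ is its centralizer in $\mathcal P_n$. $\mathcal L\subseteq C(\mathcal S)$ is a subgroup with $C(\mathcal S)=\mathcal S\mathcal L$ and $\pi(\mathcal S)\cap\pi(\mathcal L)=\{\pi(I)\}$. $\mathcal S^*$ is the $\mathbb F_2$-dual of $\mathcal S$; the syndrome $\mathrm{syn}(E')\in\mathcal S^*$ is given by $\mathrm{syn}(E')(s)=1$ iff $E'$ anticommutes with $s$. A decoding map is a map $D:\mathcal S^*\to\tilde{\mathcal P}_n$ with $D(0)=\pi(I)$ and $\mathrm{syn}(D(\sigma))=\sigma$ for all $\sigma$. Sets. $T=\pi(\mathcal S)$; $N=\pi(\mathcal S\mathcal L)=\pi(C(\mathcal S))$ (zero-syndrome errors); $K=\{E'\in\tilde{\mathcal P}_n: D(\mathrm{syn}(E'))E'\in T\}$ (correctable errors). For $A\subset\tilde{\mathcal P}_n$, $W(A;z)=\sum_{E'\in A}z^{\mathrm{wt}(E')}$. QEC-only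 protocol. A random error $E'\in\tilde{\mathcal P}_n$ occurs with probability $(1-p)^{n-\mathrm{wt}(E')}(p/3)^{\mathrm{wt}(E')}$. The syndrome $\sigma=\mathrm{syn}(E')$ is measured. If $\sigma=0$, the recovery is $R=\pi(I)$. If $\sigma\ne0$, then (independently of $E'$ given $\sigma$) with probability $1-p_{\rm QEC}$ the recovery is $R=D(\sigma)$, and with probability $p_{\rm QEC}$ it is a uniformly random $R\in\tilde{\mathcal P}_n$ with $\mathrm{syn}(R)=\sigma$. $F_{\rm QEC}$ is the probability that $RE'\in T$ (no logical error). *)

(* Defs.v *)
From HB Require Import structures.
From mathcomp Require Import all_boot all_order all_algebra all_fingroup.
From mathcomp Require Import ring.

Set Implicit Arguments.
Unset Strict Implicit.
Unset Printing Implicit Defensive.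

Import Order.TTheory GRing.Theory Num.Theory.
Import GroupScope.
Local Open Scope ring_scope.

Inductive letter := PI | PX | PY | PZ.

Definition letter_code (a : letter) : bool * bool :=
  match a with
  | PI => (false, false) | PX => (true, false)
  | PY => (true, true) | PZ => (false, true)
  end.

Definition letter_decode (c : bool * bool) : letter :=
  match c with
  | (false, false) => PI | (true, false) => PX
  | (true, true) => PY | (false, true) => PZ
  end.

Lemma letter_codeK : cancel letter_code letter_decode.
Proof. by case. Qed.

HB.instance Definition _ := Finite.copy letter (can_type letter_codeK).

(* Product of two Pauli matrices up to phase. *)
Definition letter_mul (a b : letter) : letter :=
  match a, b with
  | PI, c | c, PI => c
  | PX, PX | PY, PY | PZ, PZ => PI
  | PX, PY | PY, PX => PZ
  | PY, PZ | PZ, PY => PX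
  | PZ, PX | PX, PZ => PY
  end.

Lemma letter_mulA : associative letter_mul.
Proof. by do 3!case. Qed.

Lemma letter_mul1 : left_id PI letter_mul.
Proof. by []. Qed.

Lemma letter_mulV : left_inverse PI id letter_mul.
Proof. by case. Qed.

HB.instance Definition _ :=
  Finite_isGroup.Build letter letter_mulA letter_mul1 letter_mulV.

(* The exponent e such that a b = i^e (letter_mul a b) as 2 x 2 matrices:
   XY = iZ, YX = -iZ and cyclically. *)
Definition letter_phase (a b : letter) : 'Z_4 :=
  match a, b with
  | PX, PY | PY, PZ | PZ, PX => 1
  | PY, PX | PZ, PY | PX, PZ => -1
  | _, _ => 0
  end.

(* The Pauli group modulo phases (im_proj and ker_proj); the group law is that
   of {ffun}, i.e. letterwise. *)
Notation tpauli n := {ffun 'I_n -> letter}.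

HB.instance Definition _ n := Group.on (tpauli n).

Definition wt n (E : tpauli n) : nat := #|[set j | E j != PI]|.

(* Pauli a E stands for i^a (E_0 (x) ... (x) E_{n-1}). *)
Record pauli n := Pauli { phase : 'Z_4; letters : tpauli n }.

Definition pauli_pair n (P : pauli n) := (phase P, letters P).
Definition pair_pauli n (u : 'Z_4 * tpauli n) := Pauli u.1 u.2.

Lemma pauli_pairK n : cancel (@pauli_pair n) (@pair_pauli n).
Proof. by case. Qed.

HB.instance Definition _ n := Finite.copy (pauli n) (can_type (@pauli_pairK n)).

Definition pauli_mul n (P Q : pauli n) : pauli n :=
  Pauli (phase P + phase Q + \sum_j letter_phase (letters P j) (letters Q j))
        (letters P * letters Q)%g.

Definition pauli_inv n (P : pauli n) : pauli n := Pauli (- phase P) (letters P).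

Lemma letter_phaseA a b c :
  letter_phase a b + letter_phase (a * b)%g c
  = letter_phase b c + letter_phase a (b * c)%g.
Proof. by apply/eqP; case: a; case: b; case: c. Qed.

Lemma pauli_mulA n : associative (@pauli_mul n).
Proof.
case=> [a E] [b F] [c G]; rewrite /pauli_mul /= mulgA; congr Pauli.
have -> : a + b + \sum_j letter_phase (E j) (F j) + c
    + \sum_j letter_phase ((E * F)%g j) (G j)
  = a + b + c + \sum_j (letter_phase (E j) (F j)
                        + letter_phase (E j * F j)%g (G j)).
  by rewrite big_split (eq_bigr _ (fun j _ => congr1 (letter_phase^~ _) (ffunE _ j))) /=; ring.
rewrite (eq_bigr _ (fun j _ => letter_phaseA _ _ _)) big_split /=.
by rewrite (eq_bigr _ (fun j _ => congr1 (letter_phase _) (ffunE _ j))) /=; ring.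
Qed.

Lemma pauli_mul1 n : left_id (Pauli 0 1%g) (@pauli_mul n).
Proof.
case=> [a E]; rewrite /pauli_mul /= mul1g add0r big1 ?addr0 // => j _.
by rewrite ffunE.
Qed.

Lemma pauli_mulV n : left_inverse (Pauli 0 1%g) (@pauli_inv n) (@pauli_mul n).
Proof.
case=> [a E]; rewrite /pauli_mul /= addNr add0r big1 => [|j _]; last by case: (E j).
by congr Pauli; apply/ffunP => j; rewrite !ffunE; case: (E j).
Qed.

HB.instance Definition _ n :=
  Finite_isGroup.Build (pauli n) (@pauli_mulA n) (@pauli_mul1 n) (@pauli_mulV n).

Definition iI n : pauli n := Pauli 1 1%g.
Definition mI n : pauli n := Pauli 2%:R 1%g.

Section MatrixModel.
(* Justification of the symbolic group law by the matrices it encodes; rows and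
   columns of an n-qubit matrix are indexed by bit strings. *)
Variables (C : numClosedFieldType) (n : nat).

Definition letter_mx (a : letter) (x y : bool) : C :=
  match a with
  | PI => (x == y)%:R
  | PX => (x != y)%:R
  | PY => if x == y then 0 else if x then 'i else - 'i
  | PZ => if x == y then (-1) ^+ x else 0
  end.

Definition pauli_mx (P : pauli n) (x y : {ffun 'I_n -> bool}) : C :=
  'i ^+ phase P * \prod_j letter_mx (letters P j) (x j) (y j).

Lemma letter_mxM a b x y :
  \sum_z letter_mx a x z * letter_mx b z y
  = 'i ^+ letter_phase a b * letter_mx (a * b)%g x y.
Proof.
have i2 : 'i * 'i = -1 :> C by rewrite -expr2 sqrCi.
have i3 : 'i ^+ 3 = - 'i :> C by rewrite exprS sqrCi mulrN1.
rewrite big_bool; case: a; case: b; case: x; case: y => /=;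
  rewrite ?(expr0, expr1, i3, mul0r, mulr0, mul1r, mulr1, add0r, addr0,
            mulrN, mulNr, mulrNN, i2, opprK) //.
Qed.

Lemma exp_iD (a b : 'Z_4) : 'i ^+ (a + b)%R = 'i ^+ a * 'i ^+ b :> C.
Proof.
have i4 : 'i ^+ 4 = 1 :> C by rewrite (exprM _ 2 2) sqrCi sqrrN expr1n.
by rewrite -exprD /= expr_mod.
Qed.

Lemma pauli_mxM (P Q : pauli n) x y :
  \sum_z pauli_mx P x z * pauli_mx Q z y = pauli_mx (P * Q)%g x y.
Proof.
rewrite /pauli_mx.
have -> : phase (P * Q)%g =
  phase P + phase Q + \sum_j letter_phase (letters P j) (letters Q j) by [].
have -> : letters (P * Q)%g = (letters P * letters Q)%g by [].
rewrite !exp_iD (big_morph (fun e : 'Z_4 => 'i ^+ e : C) exp_iD (erefl _)).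
rewrite -mulrA -big_split /=.
rewrite [in RHS](eq_bigr (fun j =>
  \sum_z letter_mx (letters P j) (x j) z * letter_mx (letters Q j) z (y j))).
  rewrite bigA_distr_bigA !mulr_sumr; apply: eq_bigr => z _.
  by rewrite big_split /=; ring.
by move=> j _; rewrite ffunE letter_mxM.
Qed.

End MatrixModel.

Definition proj {n} (P : pauli n) : tpauli n := letters P.

Lemma projM n : {in [set: pauli n] &, {morph @proj n : P Q / (P * Q)%g}}.
Proof. by []. Qed.
Canonical proj_morphism n := Morphism (@projM n).

(* proj realises the quotient of the Pauli group by <iI>. *)
Lemma im_proj n : proj @: [set: pauli n] = [set: tpauli n].
Proof.
by apply/setP => E; rewrite inE; apply/imsetP; exists (Pauli 0 E).
Qed.

Lemma expg_iI n m : (iI n ^+ m)%g = Pauli m%:R 1%g.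
Proof.
elim: m => [//|m IHm]; rewrite expgS IHm.
rewrite /mulg /= /pauli_mul /= mulg1 big1 => [|j _]; last by rewrite ffunE.
by rewrite addr0 -mulrS.
Qed.

Lemma ker_proj n : 'ker (@proj n) = <[iI n]>%g.
Proof.
apply/setP => P; rewrite !inE /=; apply/eqP/cycleP => [|[m ->]].
  by case: P => a E /= ->; exists a; rewrite expg_iI natr_Zp.
by rewrite expg_iI.
Qed.

Definition anticommute n (P Q : pauli n) : bool := (P * Q == mI n * (Q * P))%g.

(* The representative with phase 1; by anticommuteE and commuteE the choice is
   immaterial for (anti)commutation. *)
Definition rep n (E : tpauli n) : pauli n := Pauli 0 E.

Definition letter_anti (a b : letter) : bool :=
  [&& a != PI, b != PI & a != b].

Lemma letter_phaseC a b :
  letter_phase a b = letter_phase b a + (letter_anti a b)%:R *+ 2.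
Proof. by apply/eqP; case: a; case: b. Qed.

Lemma tpauliC n (E F : tpauli n) : (E * F = F * E)%g.
Proof. by apply/ffunP => j; rewrite !ffunE; case: (E j); case: (F j). Qed.

Definition anti_sites n (E F : tpauli n) : nat := \sum_j letter_anti (E j) (F j).

Lemma mulP_comm n (P Q : pauli n) :
  (P * Q)%g = Pauli (phase (Q * P)%g + (anti_sites (proj P) (proj Q))%:R *+ 2)
                    (letters (Q * P)%g).
Proof.
case: P Q => [a E] [b F]; rewrite /mulg /= /pauli_mul /= tpauliC; congr Pauli.
rewrite (eq_bigr _ (fun j _ => letter_phaseC (E j) (F j))) big_split /=.
by rewrite sumrMnl natr_sum /=; ring.
Qed.

Lemma mulP_mI n (P : pauli n) : (mI n * P)%g = Pauli (2%:R + phase P) (letters P).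
Proof.
case: P => [a E]; rewrite /mulg /= /pauli_mul /= mul1g big1 ?addr0 // => j _.
by rewrite ffunE.
Qed.

Lemma Z4_double m : (m%:R *+ 2 : 'Z_4) = (odd m)%:R *+ 2.
Proof.
rewrite -{1}(odd_double_half m) natrD mulrnDl -[in X in _ + X]muln2 natrM.
have -> : ((m./2)%:R * 2%:R : 'Z_4) *+ 2 = (m./2)%:R * (2%:R *+ 2).
  by ring.
by rewrite (_ : 2%:R *+ 2 = 0 :> 'Z_4) ?mulr0 ?addr0 //; apply: val_inj.
Qed.

Lemma anticommute_odd n (P Q : pauli n) :
  anticommute P Q = odd (anti_sites (proj P) (proj Q)).
Proof.
rewrite /anticommute mulP_mI mulP_comm Z4_double.
case: (Q * P)%g => [c G] /=; case: odd.
  by apply/eqP; rewrite addrC.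
by apply/eqP => /(congr1 (@phase n)) /=; rewrite mul0rn addr0 -[LHS]add0r => /addIr.
Qed.

Lemma commute_even n (P Q : pauli n) :
  (P * Q == Q * P)%g = ~~ odd (anti_sites (proj P) (proj Q)).
Proof.
rewrite mulP_comm Z4_double.
case: (Q * P)%g => [c G] /=; case: odd.
  by apply/eqP => /(congr1 (@phase n)) /=; rewrite -[RHS]addr0 => /addrI.
by apply/eqP; rewrite mul0rn addr0.
Qed.

Lemma anticommuteE n (P Q : pauli n) :
  anticommute P Q = anticommute (rep (proj P)) (rep (proj Q)).
Proof. by rewrite !anticommute_odd. Qed.

Lemma commuteE n (P Q : pauli n) :
  (P * Q == Q * P)%g = ~~ anticommute P Q.
Proof. by rewrite commute_even anticommute_odd. Qed.

Lemma anticommuteM n (P Q1 Q2 : pauli n) :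
  anticommute P (Q1 * Q2)%g = anticommute P Q1 (+) anticommute P Q2.
Proof.
rewrite !anticommute_odd -oddD /anti_sites -big_split /=.
rewrite !(big_morph odd oddD (erefl _)); apply: eq_bigr => j _.
by rewrite ffunE; case: (letters P j); case: (letters Q1 j); case: (letters Q2 j).
Qed.

Definition dual_pred n (S : {group pauli n}) : {pred {ffun [subg S] -> 'F_2}} :=
  fun f => [forall s, forall t, f (s * t)%g == f s + f t].
Arguments dual_pred {n} S _.

Fact dual_zmod_closed n (S : {group pauli n}) : zmod_closed (dual_pred S).
Proof.
split=> [|f g /forallP fM /forallP gM].
  by apply/forallP => s; apply/forallP => t; rewrite !ffunE addr0.
apply/forallP => s; apply/forallP => t; rewrite !ffunE.
move/forallP/(_ t)/eqP: (fM s) => ->; move/forallP/(_ t)/eqP: (gM s) => ->.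
by apply/eqP; ring.
Qed.

HB.instance Definition _ n (S : {group pauli n}) :=
  GRing.isZmodClosed.Build _ (dual_pred S) (dual_zmod_closed S).

(* The F_2-dual of S: homomorphisms from S to the additive group of F_2, under
   pointwise addition; 0 is the trivial syndrome. *)
Record dual n (S : {group pauli n}) :=
  Dual { dual_val :> {ffun [subg S] -> 'F_2}; _ : dual_val \in dual_pred S }.

HB.instance Definition _ n (S : {group pauli n}) :=
  [isSub for @dual_val n S].
HB.instance Definition _ n (S : {group pauli n}) := [Finite of dual S by <:].
HB.instance Definition _ n (S : {group pauli n}) :=
  [SubChoice_isSubZmodule of dual S by <:].

Fact syn_subproof n (S : {group pauli n}) (E : tpauli n) :
  [ffun s : [subg S] => (anticommute (rep E) (sgval s))%:R : 'F_2]
    \in dual_pred S.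
Proof.
apply/forallP => s; apply/forallP => t; rewrite !ffunE anticommuteM.
by do 2!case: anticommute.
Qed.

Definition syn n (S : {group pauli n}) (E : tpauli n) : dual S :=
  Dual (syn_subproof S E).

Definition stabilizer_group n k (S : {group pauli n}) : Prop :=
  #|S| = (2 ^ (n - k))%N /\ mI n \notin S.

Definition logical_group n (S L : {group pauli n}) : Prop :=
  [/\ L \subset 'C(S)%g, 'C(S)%g = (S * L)%g
    & proj @: S :&: proj @: L = [set proj 1%g]].

Definition decoding_map n (S : {group pauli n}) (D : dual S -> tpauli n) : Prop :=
  D 0 = proj 1%g /\ forall sigma, syn S (D sigma) = sigma.

Section CodeSets.
Variables (n : nat) (S L : {group pauli n}) (D : dual S -> tpauli n).

Definition trivial_errors : {set tpauli n} := proj @: S.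

Definition zero_syn_errors : {set tpauli n} := proj @: (S * L)%g.

Definition correctable_errors : {set tpauli n} :=
  [set E | (D (syn S E) * E)%g \in trivial_errors].

End CodeSets.

Definition wtenum (R : realFieldType) n (A : {set tpauli n}) (z : R) : R :=
  \sum_(E in A) z ^+ wt E.

Section QECProtocol.
Variables (R : realFieldType) (n : nat) (S : {group pauli n}).
Variables (D : dual S -> tpauli n) (p pQEC : R).

Definition error_prob (E : tpauli n) : R :=
  (1 - p) ^+ (n - wt E) * (p / 3%:R) ^+ wt E.

(* Probability of the recovery F given the syndrome sigma. *)
Definition recovery_prob (sigma : dual S) (F : tpauli n) : R :=
  if sigma == 0 then (F == proj 1%g)%:R
  else (1 - pQEC) * (F == D sigma)%:R
       + pQEC * ((syn S F == sigma)%:R / #|[set G | syn S G == sigma]|%:R).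

(* Joint distribution of the pair (error, recovery). *)
Definition qec_prob (u : tpauli n * tpauli n) : R :=
  error_prob u.1 * recovery_prob (syn S u.1) u.2.

Definition F_QEC : R :=
  \sum_(u | (u.2 * u.1)%g \in trivial_errors S) qec_prob u.

Lemma error_prob_sum1 : \sum_E error_prob E = 1.
Proof.
have prodE E : error_prob E = \prod_j (if E j != PI then p / 3%:R else 1 - p).
  rewrite (bigID (fun j => E j != PI)) /=.
  rewrite (eq_bigr (fun=> p / 3%:R)) => [|j ->] //.
  rewrite [X in _ * X](eq_bigr (fun=> 1 - p)) => [|j /negPf->] //.
  rewrite !prodr_const mulrC; congr (_ ^+ _ * _ ^+ _).
    by rewrite -[X in (X - _)%N]card_ord -(cardC [pred j | E j != PI]) /wt cardsE addKn.
  by rewrite /wt cardsE.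
rewrite (eq_bigr _ (fun E _ => prodE E)).
rewrite -(bigA_distr_bigA (fun (j : 'I_n) a => if a != PI then p / 3%:R else 1 - p)).
rewrite big1 // => j _.
have letterE (F : letter -> R) : \sum_a F a = F PI + F PX + F PY + F PZ.
  rewrite (bigD1 PI) // (bigD1 PX) // (bigD1 PY) // (bigD1 PZ) //= big1.
    by rewrite addr0 !addrA.
  by case.
by rewrite letterE /=; field.
Qed.

Lemma qec_prob_sum1 : decoding_map D -> \sum_u qec_prob u = 1.
Proof.
move=> [_ synD]; rewrite -(pair_bigA _ (fun E F => qec_prob (E, F))) /=.
rewrite -error_prob_sum1; apply: eq_bigr => E _.
rewrite /qec_prob /= -mulr_sumr -[RHS]mulr1; congr (_ * _).
rewrite /recovery_prob; case: eqP => _.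
  by rewrite (bigD1 (proj 1%g)) //= eqxx big1 ?addr0 // => F /negPf->.
rewrite big_split -!mulr_sumr /= (bigD1 (D (syn S E))) //= eqxx.
rewrite big1 => [|F /negPf-> //]; rewrite -mulr_suml -natr_sum.
rewrite -big_mkcond sum1_card -cardsE divff ?addr0 ?mulr1 ?subrK //.
rewrite pnatr_eq0 -lt0n card_gt0; apply/set0Pn; exists E.
by rewrite inE; exact: (eqxx (syn S E)).
Qed.

End QECProtocol.

(* Main.v *)
(* Work mod phases.  N is the kernel of the syndrome and T lies inside N, so
   every nonzero syndrome class is a coset of N, and the recoveries in it that
   succeed form a coset of T.  A random recovery therefore succeeds with
   probability |T| / |N|, which equals 4^-k since evaluating the sum over E and
   s in S of (-1)^[E, s anticommute] in both orders gives |N| |S| = 4^n.  The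
   error distribution is z^wt normalised, and both formulas then hold error by
   error. *)
Require Import Defs.
From HB Require Import structures.
From mathcomp Require Import all_boot all_order all_algebra all_fingroup.
From mathcomp Require Import ring.

Set Implicit Arguments.
Unset Strict Implicit.
Unset Printing Implicit Defensive.

Import Order.TTheory GRing.Theory Num.Theory.
Import GroupScope.
Local Open Scope ring_scope.

(** Translation by [a] permutes [G] and flips every sign, so the sum equals its own opposite. *)
Lemma sum_sign_morph (R : numDomainType) (gT : finGroupType) (G : {group gT})
    (f : gT -> bool) (a : gT) :
  {in G &, forall x y, f (x * y)%g = f x (+) f y} -> a \in G -> f a ->
  \sum_(x in G) (-1) ^+ f x = 0 :> R.
Proof.
move=> fM aG fa; set s := LHS; have: s = - s.
  rewrite {1}/s (reindex_inj (mulgI a)) /= -sumrN; apply: eq_big => x.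
    exact: groupMl.
  by rewrite groupMl // => xG; rewrite fM // fa signr_addb mulN1r.
by move/eqP; rewrite -subr_eq0 opprK -mulr2n mulrn_eq0 /= => /eqP.
Qed.

(** * Anticommutation and syndromes modulo phases *)

Section Stabilizer.
Variable n : nat.
Implicit Types (P Q : pauli n) (E F : tpauli n) (S : {group pauli n}).

Lemma anticommuteC P Q : anticommute P Q = anticommute Q P.
Proof. by apply: negb_inj; rewrite -!commuteE eq_sym. Qed.

(** [rep] is not multiplicative, but [rep (E * F)] and [rep E * rep F] differ only by a phase, which
    anticommutation ignores. *)
Lemma anticommute_repM E F P :
  anticommute (rep (E * F)%g) P
  = anticommute (rep E) P (+) anticommute (rep F) P.
Proof.
rewrite anticommuteE -[proj (rep _)]/(proj (rep E * rep F)%g) -anticommuteE.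
by rewrite anticommuteC anticommuteM !(anticommuteC P).
Qed.

Lemma tpauli_expg2 E : (E * E)%g = 1%g.
Proof. by apply/ffunP => j; rewrite !ffunE; case: (E j). Qed.

Lemma tpauli_mulK E : involutive (fun F => E * F)%g.
Proof. by move=> F; rewrite mulgA tpauli_expg2 mul1g. Qed.

Lemma card_tpauli : #|[set: tpauli n]| = (4 ^ n)%N.
Proof.
rewrite cardsT card_ffun card_ord; congr (_ ^ _)%N.
have decodeK : cancel letter_decode letter_code by case=> [] [] [].
by rewrite (bij_eq_card (Bijective letter_codeK decodeK)) card_prod card_bool.
Qed.

Lemma exists_anticommute P : proj P != 1%g -> exists E, anticommute (rep E) P.
Proof.
move=> P1; have [j Pj]: exists j, proj P j != PI.
  apply/existsP; apply: contraR P1; rewrite negb_exists => /forallP PI_P.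
  by apply/eqP/ffunP => j; rewrite ffunE; apply/eqP/negPn.
(* A letter anticommuting with the one of [P] at site [j]: [PZ] against [PX], and [PX] against [PY]
   or [PZ]. *)
pose a := if proj P j == PX then PZ else PX.
exists [ffun i => if i == j then a else PI].
rewrite anticommute_odd /anti_sites (bigD1 j) //= big1 => [|i /negPf ij].
  by rewrite ffunE eqxx addn0 /a; case: (proj P j) Pj.
by rewrite ffunE ij.
Qed.

Lemma syn_eq0 S E : (syn S E == 0) = (rep E \in 'C(S))%g.
Proof.
apply/eqP/centP => [synE0 s sS | cE].
  apply/eqP; rewrite commuteE.
  have := congr1 (fun f : dual S => dual_val f (subg S s)) synE0.
  by rewrite /= !ffunE subgK //; case: anticommute.
apply/val_inj/ffunP => s; rewrite /= !ffunE.
by move/eqP: (cE _ (subgP s)); rewrite commuteE => /negPf->.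
Qed.

Lemma synM S E F : syn S (E * F)%g = syn S E + syn S F.
Proof.
apply/val_inj/ffunP => s; rewrite /= !ffunE anticommute_repM.
by do 2!case: anticommute; apply/eqP.
Qed.

Lemma syn1 S : syn S 1%g = 0.
Proof. by apply/eqP; rewrite syn_eq0; exact: group1. Qed.

Lemma synMeq S E F : (syn S (E * F)%g == 0) = (syn S E == syn S F).
Proof.
rewrite synM -[X in _ + X]opprK subr_eq0; congr (_ == _).
(* Since [F] squares to 1, its syndrome is its own opposite. *)
by apply/eqP; rewrite eq_sym -addr_eq0 -synM tpauli_expg2 syn1.
Qed.

Lemma mem_cent_proj S P : (rep (proj P) \in 'C(S))%g = (P \in 'C(S))%g.
Proof.
by apply/centP/centP => cP s sS; apply/eqP; move/eqP: (cP s sS);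
   rewrite !commuteE anticommuteE [in X in _ -> X]anticommuteE.
Qed.

Lemma zero_syn_errorsE S (L : {group pauli n}) :
  'C(S)%g = (S * L)%g -> zero_syn_errors S L = [set E | syn S E == 0].
Proof.
move=> CSL; apply/setP => E; rewrite inE syn_eq0 /zero_syn_errors -CSL.
apply/imsetP/idP => [[P cP ->]|cE]; first by rewrite mem_cent_proj.
by exists (rep E).
Qed.

(** * Sizes of T and N for a group without -I *)

Section NoMinusOne.
Variable S : {group pauli n}.
Hypothesis SmI : mI n \notin S.

(** An anticommuting pair in [S] would put -I = PQ(QP)^-1 in [S]. *)
Lemma stabilizer_abelian : abelian S.
Proof.
apply/centsP => P PS Q QS; apply/eqP; rewrite commuteE.
apply: contra SmI => /eqP PQ.
by rewrite -[mI n](mulgK (Q * P)%g) -PQ groupM ?groupV ?groupM.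
Qed.

(** Makes [proj] injective on [S]. An element i^a I of [S] is -I itself when a = 2 and squares to -I
    when a is 1 or 3, so only a = 0 is left. *)
Lemma stabilizer_proj1 P : P \in S -> proj P = 1%g -> P = 1%g.
Proof.
case: P => a E PS /= E1; rewrite /proj /= in E1; subst E.
have sqP : Pauli (a + a) 1%g \in S.
  have := groupM PS PS; rewrite {1}/mulg /= /pauli_mul /= mulg1 big1 ?addr0 //.
  by move=> j _; rewrite ffunE.
move: PS sqP (SmI); case: a => [[|[|[|[|//]]]] lt_a] PS sqP.
- by move=> _; congr Pauli; exact: val_inj.
- by case/negP; rewrite /mI (_ : 2%:R = Ordinal lt_a + Ordinal lt_a) //; exact: val_inj.
- by case/negP; rewrite /mI (_ : 2%:R = Ordinal lt_a) //; exact: val_inj.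
- by case/negP; rewrite /mI (_ : 2%:R = Ordinal lt_a + Ordinal lt_a) //; exact: val_inj.
Qed.

Lemma card_trivial_errors : #|trivial_errors S| = #|S|.
Proof.
rewrite card_in_imset // => P Q PS QS PQ; apply/eqP.
rewrite eq_mulgV1; apply/eqP/stabilizer_proj1; first by rewrite groupM ?groupV.
(* Inversion keeps the letters, so the product projects to a square. *)
by rewrite -[proj _]/(proj P * proj Q^-1)%g PQ; exact: tpauli_expg2.
Qed.

Lemma trivial_errors_syn0 E : E \in trivial_errors S -> syn S E = 0.
Proof.
case/imsetP=> P PS ->; apply/eqP; rewrite syn_eq0 mem_cent_proj.
exact: subsetP stabilizer_abelian _ PS.
Qed.

Lemma card_syn0 : (#|[set E | (syn S E == 0)%R]| * #|S| = 4 ^ n)%N.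
Proof.
(* Column sums: a nontrivial [P] in [S] has nontrivial letters, hence anticommutes with some [E],
   and the signs over all errors cancel. *)
pose sgn E P : int := (-1) ^+ anticommute (rep E) P.
have sumE P : P \in S -> \sum_E sgn E P = (4 ^ n * (P == 1%g))%N%:R.
  move=> PS; have [->|P1] := eqVneq P 1%g.
    rewrite muln1 -card_tpauli -sumr_const; apply: eq_big => [E|E _].
      by rewrite inE.
    rewrite /sgn (_ : anticommute _ _ = false) //; apply: negbTE.
    by rewrite -commuteE mulg1 mul1g.
  have [E aE]: exists E, anticommute (rep E) P.
    by apply: exists_anticommute; apply: contraNneq P1 => /stabilizer_proj1->.
  rewrite muln0; under eq_bigl => F do rewrite -(in_setT F).
  apply: (@sum_sign_morph _ _ [set: tpauli n]%G
            (fun F => anticommute (rep F) P) E) => //; last exact: in_setT.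
  by move=> E1 E2 _ _; apply: anticommute_repM.
(* Row sums: the signs over [S] cancel as soon as the syndrome of [E] is nonzero. *)
have sumS E : \sum_(P in S) sgn E P = (#|S| * (syn S E == 0)%R)%N%:R.
  case: eqP => [/eqP|/eqP]; rewrite syn_eq0.
    move/centP=> cE; rewrite muln1 -sumr_const; apply: eq_bigr => P PS.
    by rewrite /sgn; move/eqP: (cE P PS); rewrite commuteE => /negPf->.
  move=> ncE; have [P PS aP]: exists2 P, P \in S & anticommute (rep E) P.
    apply/exists_inP; apply: contraR ncE; rewrite negb_exists_in => /forall_inP cE.
    by apply/centP => P PS; apply/eqP; rewrite commuteE cE.
  rewrite muln0 (sum_sign_morph _ _ PS) // => P1 P2 _ _; exact: anticommuteM.
apply/eqP; rewrite -(eqr_nat int).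
have -> : (4 ^ n)%:R = \sum_(P in S) \sum_E sgn E P :> int.
  rewrite (eq_bigr _ sumE) (bigD1 1%g) //= eqxx muln1 big1 ?addr0 // => P.
  by case/andP=> _ /negPf->; rewrite muln0.
rewrite exchange_big (eq_bigr _ (fun E _ => sumS E)) -natr_sum -big_distrr /=.
by rewrite mulnC -sum1dep_card big_mkcond.
Qed.

End NoMinusOne.
End Stabilizer.

(** * Success probability of the recovery and normalisation of the error distribution *)

Section Recovery.
Variables (R : realFieldType) (n : nat).
Implicit Types (E F : tpauli n) (S : {group pauli n}).

(** The ratio is |S|^2 / 4^n with |S|^2 = 4^(n-k); [k <= n] makes the truncated subtraction
    exact. *)
Lemma trivial_card_ratio k S : (k <= n)%N -> stabilizer_group k S ->
  #|trivial_errors S|%:R / #|[set E | syn S E == 0]|%:R = 4 ^- k :> R.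
Proof.
move=> le_kn [cardS SmI]; have cardN := card_syn0 SmI.
have N0 : #|[set E | syn S E == 0]|%:R != 0 :> R.
  rewrite pnatr_eq0; apply: contraTneq (expn_gt0 4 n) => N0.
  by rewrite -cardN N0.
have S0 : #|S|%:R != 0 :> R by rewrite pnatr_eq0 -lt0n cardG_gt0.
apply: (canLR (mulfK N0)); apply: (mulIf S0).
rewrite -mulrA -!natrM cardN card_trivial_errors // cardS.
apply: (canRL (mulKf _)); first by rewrite expf_neq0 ?pnatr_eq0.
rewrite -natrX -natrM; congr (_%:R).
by rewrite -expnMn -[(2 * 2)%N]/4%N -expnD subnKC.
Qed.

(** Multiplication by [E] is an involution that carries the kernel of the syndrome onto the class of
    [E]. *)
Lemma card_syn_class S E :
  #|[set F | syn S F == syn S E]| = #|[set F | syn S F == 0]|.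
Proof.
rewrite -[RHS](card_imset _ (can_inj (tpauli_mulK E))); apply: eq_card => F.
rewrite [LHS]inE -synMeq; apply/idP/imsetP => [FE|[G + ->]].
  by exists (E * F)%g; rewrite ?tpauli_mulK // inE tpauliC.
by rewrite inE [(_ * E)%g]tpauliC tpauli_mulK.
Qed.

(** The conditional probability of no logical error, given the error [E]. *)
Lemma success_recovery_prob k S (D : dual S -> tpauli n) (q : R) E :
  (k <= n)%N -> stabilizer_group k S -> decoding_map D ->
  \sum_(F | (F * E)%g \in trivial_errors S) recovery_prob D q (syn S E) F
  = if syn S E == 0 then (E \in trivial_errors S)%:R
    else (1 - q) * (E \in correctable_errors D)%:R + q * 4 ^- k.
Proof.
move=> le_kn hS [D0 synD]; rewrite /recovery_prob; case: ifPn => [_|_].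
  rewrite big_mkcond (bigD1 (proj 1%g)) //= big1 => [|F /negPf->].
    by rewrite addr0 eqxx (_ : (proj 1 * E)%g = E) ?mul1g //; case: ifP.
  by case: ifP.
rewrite big_split -!mulr_sumr; congr (_ * _ + _ * _).
  rewrite inE big_mkcond (bigD1 (D (syn S E))) //= eqxx big1 => [|F /negPf->].
    by rewrite addr0; case: ifP.
  by case: ifP.
rewrite -mulr_suml card_syn_class -(trivial_card_ratio le_kn hS).
(* The successful recoveries form the coset of T through [E]. T has zero syndrome, so the coset
   stays in the syndrome class of [E] and each indicator is 1. *)
congr (_ / _); rewrite (eq_bigr (fun=> 1)) => [|F FE].
  rewrite sumr_const; congr (_ *+ _).
  rewrite -(card_imset _ (can_inj (tpauli_mulK E))); apply: eq_card => F.
  apply/imsetP/idP => [[G GT ->]|FT]; first by rewrite tpauliC.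
  by exists (E * F)%g; rewrite ?unfold_in /= ?[(_ * E)%g]tpauliC tpauli_mulK.
by rewrite -synMeq (trivial_errors_syn0 hS.2 FE) eqxx.
Qed.

Lemma wtenum_indic (A : {set tpauli n}) (z : R) :
  wtenum A z = \sum_E z ^+ wt E * (E \in A)%:R.
Proof.
rewrite /wtenum big_mkcond; apply: eq_bigr => E _.
by case: ifP; rewrite ?mulr1 ?mulr0.
Qed.

(** Pulling out (1-p)^n leaves z^wt with z = p/(3-3p). As the probabilities sum to 1, that factor
    must be the inverse of the full enumerator. *)
Lemma error_probE (p : R) E : p < 1 ->
  error_prob p E
  = (wtenum [set: tpauli n] (p / (3 - 3 * p)))^-1 * (p / (3 - 3 * p)) ^+ wt E.
Proof.
move=> p1; have q0 : 1 - p != 0 by rewrite subr_eq0 eq_sym lt_eqF.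
have z3 : p / 3 = (1 - p) * (p / (3 - 3 * p)).
  rewrite (_ : 3 - 3 * p = 3 * (1 - p)); [by field | ring].
have errE F : error_prob p F = (1 - p) ^+ n * (p / (3 - 3 * p)) ^+ wt F.
  rewrite /error_prob z3 exprMn mulrA -exprD subnK //.
  by rewrite /wt (leq_trans (max_card _)) // card_ord.
rewrite errE.
have /mulr1_eq -> // :
  wtenum [set: tpauli n] (p / (3 - 3 * p)) * (1 - p) ^+ n = 1.
  rewrite mulrC mulr_sumr -[RHS](error_prob_sum1 n p).
  by apply: eq_big => [F|F _]; rewrite ?inE ?errE.
Qed.

End Recovery.

Theorem lemma8 (R : realFieldType) (n k : nat) (S L : {group pauli n})
    (D : dual S -> tpauli n) (p pQEC : R)
    (hk : (1 <= k <= n)%N)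
    (hS : stabilizer_group k S)
    (hL : logical_group S L)
    (hD : decoding_map D)
    (hp : 0 <= p < 1)
    (hq : 0 <= pQEC <= 1) :
  let W (A : {set tpauli n}) := wtenum A (p / (3 - 3 * p)) in
  let P := [set: tpauli n] in
  let T := trivial_errors S in
  let N := zero_syn_errors S L in
  let K := correctable_errors D in
  1 - F_QEC D p pQEC
    = (W P)^-1 * (W (N :\: T) + W (P :\: (K :|: N))
        + pQEC * (W (K :\: T)
                  - 4 ^- k * (W (P :\: (K :|: N)) + W (K :\: T))))
  /\ 1 - F_QEC D p pQEC
    = (W P)^-1 * (W (P :\: K)
        + pQEC * (W (K :\: T) - 4 ^- k * W (P :\: N))).
Proof.
move=> W P T N K; have [/andP[_ p1] /andP[_ le_kn]] := (hp, hk).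
have [[[_ SmI] [_ CSL _]] [D0 _]] := (hS, hL, hD).
set z := p / _ in W *.
(* Writing 1 as the total error probability turns the infidelity into a single sum over errors. *)
have FE : 1 - F_QEC D p pQEC = (W P)^-1 * \sum_E z ^+ wt E * (1 -
    (if syn S E == 0 then (E \in T)%:R
     else (1 - pQEC) * (E \in K)%:R + pQEC * 4 ^- k)).
  rewrite -[X in X - _](error_prob_sum1 n p) /F_QEC /qec_prob.
  rewrite -(pair_big_dep xpredT (fun E F => (F * E)%g \in trivial_errors S)
    (fun E F => error_prob p E * recovery_prob D pQEC (syn S E) F)) /=.
  rewrite -sumrB mulr_sumr; apply: eq_bigr => E _.
  rewrite -mulr_sumr (success_recovery_prob _ _ le_kn hS hD) error_probE //.
  by rewrite mulrA mulrBr mulr1.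
have memN E : (E \in N) = (syn S E == 0).
  by rewrite /N zero_syn_errorsE // inE.
have memT E : syn S E != 0 -> (E \in T) = false.
  by move=> E0; apply: contraNF E0 => ET; apply/eqP/trivial_errors_syn0.
(* On zero syndrome the decoder returns the identity, so correctable means trivial. *)
have memK E : syn S E == 0 -> (E \in K) = (E \in T).
  by move/eqP=> E0; rewrite inE E0 D0 (_ : (proj 1 * E)%g = E) ?mul1g.
rewrite FE /W !wtenum_indic.
split; congr (_ * _); rewrite !(mulr_sumr, =^~ big_split, =^~ sumrB) /=;
  apply: eq_bigr => E _; move: (memT E) (memK E); rewrite !(in_setD, in_setU, in_setT) memN.
(* One membership is left undecided: in T for zero syndrome, in K otherwise. Each of its two values
   gives a polynomial identity. *)
all: case: (syn S E == 0) => [_ /(_ isT)->|/(_ isT)-> _].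
all: case: (E \in _); rewrite ?andbT ?andbF /=; ring.
Qed.
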